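(* Let $\mathcal{L}$ be a tree automatic scattered linear ordering whose domain $\operatorname{dom}(\mathcal{L})\subseteq T_\Sigma$ is fat. Then $\mathcal{L}$ is not word automatic.
   Context: A tree domain is a non-empty finite prefix-closed $D\subseteq\{0,1\}^\star$ with $u0\in D$ iff $u1\in D$ for all $u\in D$; a tree over the finite alphabet $\Sigma$ is a map $t\colon D\to\Sigma$ with $\operatorname{dom}(t)=D$; $T_\Sigma$ is the set of trees. Thickness is $\max_\ell|\operatorname{dom}(t)\cap\{0,1\}^\ell|$; a set of trees is fat if the thickness of its members is unbounded. A tree automatic linear ordering is a structure $(L;<)$, $<$ a strict linear order, with $L\subseteq T_\Sigma$ recognised by a deterministic bottom-up tree automaton and the set of convolutions $\otimes(s,t)$ of pairs $s<t$ also recognised by a tree automaton (convolution: tree on $\operatorname{dom}(s)\cup\operatorname{dom}(t)$ labelled by pairs of labels, padded by a symbol $\Box$ where undefined). A structure is word automatic if it is isomorphic to a structure whose domain is a regular language of finite words and whose relations have regular word convolutions (pairs of words written letter by letter, shorter one padded with $\Box$). A linear ordering is scattered if $(\mathbb{Q};<)$ does not embed into it. *)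

(* Defs.v *)
From HB Require Import structures.
From mathcomp Require Import all_boot all_order all_algebra.
From mathcomp Require Import finmap all_classical.

Set Implicit Arguments.
Unset Strict Implicit.
Unset Printing Implicit Defensive.

Local Open Scope fset_scope.
Local Open Scope classical_set_scope.

(* In a word over {0,1}, 0 is [false] and 1 is [true]; [rcons u b] is the word
   ub, and u is a prefix of every word [u ++ v]. *)
Definition tree_domain (D : {fset seq bool}) : Prop :=
  [/\ D != fset0,
      forall u v, u ++ v \in D -> u \in D
    & forall u, rcons u false \in D <-> rcons u true \in D].

Record tree (A : finType) := Tree {
  tree_map : {fmap seq bool -> A};
  tree_mapP : `[< tree_domain (domf tree_map) >]
}.

HB.instance Definition _ (A : finType) := [isSub for @tree_map A].
HB.instance Definition _ (A : finType) := [Choice of tree A by <:].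

Definition dom (A : finType) (t : tree A) : {fset seq bool} :=
  domf (tree_map t).

(* The label of the node [u], and [None] when [u] is not in the domain. *)
Definition label (A : finType) (t : tree A) (u : seq bool) : option A :=
  (tree_map t).[? u]%fmap.

Definition level_size (A : finType) (t : tree A) (l : nat) : nat :=
  #|` [fset u in dom t | size u == l] |.

(* The maximum is taken over the levels that contain a node; all the other
   levels have size 0. *)
Definition thickness (A : finType) (t : tree A) : nat :=
  \max_(u <- dom t) level_size t (size u).

Definition fat (A : finType) (L : set (tree A)) : Prop :=
  forall k : nat, exists2 t, L t & (k < thickness t)%N.

(* The padding symbol is [None]. *)
Definition tree_conv_map (A : finType) (s t : tree A) :
    {fmap seq bool -> (option A * option A)%type} :=
  [fmap u : (dom s `|` dom t)%fset => (label s (val u), label t (val u))].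

Lemma tree_conv_mapP (A : finType) (s t : tree A) :
  `[< tree_domain (domf (tree_conv_map s t)) >].
Proof.
have /asboolP[/fset0Pn[x xs] sp sb] := tree_mapP s.
have /asboolP[_ tp tb] := tree_mapP t.
apply/asboolP; split => /=.
- by apply/fset0Pn; exists x; rewrite in_fsetU xs.
- move=> u v; rewrite !in_fsetU => /orP[/sp ->//|/tp ->].
  by rewrite orbT.
- move=> u; rewrite !in_fsetU.
  by split=> /orP[/sb ->|/tb ->]; rewrite ?orbT.
Qed.

Definition tree_conv (A : finType) (s t : tree A) :
    tree (option A * option A)%type :=
  Tree (tree_conv_mapP s t).

(* Deterministic bottom-up tree automata. *)
Record tree_automaton (A : finType) := TreeAutomaton {
  ta_state : finType;
  ta_leaf : A -> ta_state;
  ta_node : A -> ta_state -> ta_state -> ta_state;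
  ta_final : {set ta_state}
}.

(* The values of a run on the nodes of [t] are determined from the leaves
   upwards; its values outside the domain of [t] are irrelevant. *)
Definition tree_run (A : finType) (M : tree_automaton A) (t : tree A)
    (rho : seq bool -> ta_state M) : Prop :=
  forall (u : seq bool) (a : A), label t u = Some a ->
    rho u = if rcons u false \in dom t
            then ta_node a (rho (rcons u false)) (rho (rcons u true))
            else ta_leaf M a.

Definition tree_accepts (A : finType) (M : tree_automaton A) (t : tree A) :
    Prop :=
  exists2 rho, tree_run t rho & rho [::] \in ta_final M.

Definition tree_regular (A : finType) (L : set (tree A)) : Prop :=
  exists M : tree_automaton A, L = [set t | tree_accepts M t].

Definition strict_linear_order (T : Type) (lt : T -> T -> Prop) : Prop :=
  [/\ forall x, ~ lt x x,
      forall x y z, lt x y -> lt y z -> lt x z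
    & forall x y, [\/ lt x y, x = y | lt y x]].

Definition tree_automatic_linear_order (A : finType) (L : set (tree A))
    (lt : L -> L -> Prop) : Prop :=
  [/\ strict_linear_order lt,
      tree_regular L
    & tree_regular
        [set w | exists s t : L, lt s t /\ w = tree_conv (val s) (val t)]].

Definition scattered (T : Type) (lt : T -> T -> Prop) : Prop :=
  ~ exists f : rat -> T, injective f /\
      forall x y : rat, (x < y)%R <-> lt (f x) (f y).

Record dfa (A : finType) := Dfa {
  dfa_state : finType;
  dfa_init : dfa_state;
  dfa_step : dfa_state -> A -> dfa_state;
  dfa_final : {set dfa_state}
}.

Definition dfa_accepts (A : finType) (M : dfa A) (w : seq A) : bool :=
  foldl (@dfa_step A M) (dfa_init M) w \in dfa_final M.

Definition regular (A : finType) (W : set (seq A)) : Prop :=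
  exists M : dfa A, W = [set w | dfa_accepts M w].

Definition word_conv (A : finType) (u v : seq A) :
    seq (option A * option A)%type :=
  mkseq (fun i => (onth u i, onth v i)) (maxn (size u) (size v)).

Definition word_automatic (T : Type) (lt : T -> T -> Prop) : Prop :=
  exists (A : finType) (W : set (seq A)) (R : W -> W -> Prop),
    [/\ regular W,
        regular
          [set w | exists u v : W, R u v /\ w = word_conv (val u) (val v)]
      & exists2 f : T -> W, bijective f &
          forall x y : T, lt x y <-> R (f x) (f y)].

(* Main.v *)
Require Import Defs.
From mathcomp Require Import all_boot all_order all_algebra finmap all_classical.

(* Call a set in a linear order 0-large if it is non-empty and (k+1)-large if it
   contains a sequence of k-large sets, each below the next; so omega^k is
   k-large. A k-large finite union has a k-large member.

   A word automatic order is cut, inside an interval (u, v), into finitely many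
   cylinders (all words with a given prefix of length >= |u|, |v|), and up to
   isomorphism finitely many orders arise. Hence for some N every N-large
   interval is k-large for all k; such intervals can be split into two intervals
   of the same kind, so a k-large order for all k contains the rationals.

   In a fat regular tree language some tree has a path with m branchings at
   which the subtree off the path can be replaced independently by infinitely
   many trees, chosen by Ramsey's theorem so that the comparison automaton sees
   only the order of their indices. This embeds an order on nat^m which depends
   only on the signs of the differences of coordinates, and such an order is
   lexicographic up to permuting and reversing coordinates; so the order or its
   converse is m/2-large. *)

Set Implicit Arguments.
Unset Strict Implicit.
Unset Printing Implicit Defensive.

Local Open Scope classical_set_scope.

(** * Dependent choice, pigeonhole and Ramsey arguments *)

(** Dependent choice with full history: an extension need only exist for histories whose entries
    were themselves admissible, so [Q] can carry the invariant of a construction. *)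
Lemma history_choice (T : Type) (Q : seq T -> T -> Prop) :
    (forall s, (forall i x0, (i < size s)%N -> Q (take i s) (nth x0 s i)) ->
       exists w, Q s w) ->
  exists g : nat -> T, forall n, Q (mkseq g n) (g n).
Proof.
move=> ext.
have [w0 _] : exists w, Q [::] w by apply: ext.
(* At a history without extension [next] takes the arbitrary value [w0]; the histories built below
   are never of this kind. *)
have /choice[next nextP] : forall s, exists w, (exists w', Q s w') -> Q s w.
  by move=> s; have [[w]|?] := pselect (exists w, Q s w); [exists w|exists w0].
pose build := fix build n := if n is m.+1 then rcons (build m) (next (build m))
                             else [::].
exists (fun n => next (build n)).
have buildE n : build n = mkseq (fun n => next (build n)) n.
  by elim: n => //= n IH; rewrite mkseqS -IH.
elim/ltn_ind => n IH; rewrite -buildE.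
apply/nextP/ext => i x0; rewrite {1}buildE size_mkseq => lt_in.
have := IH i lt_in; rewrite (buildE n) (nth_mkseq x0 _ lt_in).
suff -> : take i (mkseq (fun n => next (build n)) n) =
          mkseq (fun n => next (build n)) i by [].
by rewrite -map_take take_iota; move/ltnW/minn_idPl: lt_in => ->.
Qed.

(** Take for each [a] a level where [P a] fails, or 0 if there is none; [N] is the maximum over the
    finite type. *)
Lemma antitone_stabilizes (F : finType) (P : F -> nat -> Prop) :
    (forall a k, P a k.+1 -> P a k) ->
  exists N, forall a, P a N -> forall k, P a k.
Proof.
move=> Pdec.
have Ple a k l : (k <= l)%N -> P a l -> P a k.
  by move=> /subnK <-; elim: (l - k)%N => //= d IH /Pdec.
have /choice[K KP] : forall a, exists N, P a N -> forall k, P a k.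
  move=> a; case: (pselect (forall k, P a k)) => [Pa|/existsNP[k nPk]].
    by exists 0%N.
  by exists k => /nPk.
exists (\max_a K a) => a /(Ple a (K a)) PaK k.
by apply: KP; apply: PaK; exact: leq_bigmax.
Qed.

Lemma ultra_pigeonhole (T : Type) (F : finType) (U : set_system T)
    {UU : UltraFilter U} (h : T -> F) :
  exists a, U [set x | h x = a].
Proof.
suff Uh (s : seq F) : U [set x | h x \in s] -> exists a, U [set x | h x = a].
  by apply: (Uh (enum F)); apply: filterS filterT => x _ /=; rewrite mem_enum.
elim: s => [|a s IH] Us; first by have [x] := filter_ex Us.
have [Ua|Uca] := in_ultra_setVsetC [set x | h x = a] UU; first by exists a.
apply: IH; apply: filterS (filterI Us Uca) => x /= [].
by rewrite in_cons => /predU1P[].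
Qed.

(** An ultrafilter [U] extending the cofinite filter gives every [x] a limit colour [col x], and
    [U]-almost all [x] share one limit colour [a]. Among these, each new element is taken from a
    finite intersection of sets in [U]. *)
Lemma ramsey_pairs (F : finType) (c : nat -> nat -> F) :
  exists (f : nat -> nat) (a : F), forall i j, (i < j)%N ->
    (f i < f j)%N /\ c (f i) (f j) = a.
Proof.
have [U [UU ooU]] := ultraFilterLemma eventually_filter.
have /choice[col Ucol] : forall x, exists a, U [set y | c x y = a].
  by move=> x; exact: ultra_pigeonhole.
have [a Ua] := ultra_pigeonhole (U := U) col.
pose Q (s : seq nat) w := col w = a /\ forall x, x \in s -> (x < w)%N /\ c x w = a.
have [s sQ|f fQ] := @history_choice _ Q.
  have sa x : x \in s -> col x = a.
    by move=> xs; have := sQ (index x s) x;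
      rewrite index_mem nth_index // => /(_ xs)[].
  have : U [set w | forall x, x \in s -> (x < w)%N /\ c x w = a].
    elim: s {sQ} sa => [|x s IH] sa; first by apply: filterS filterT.
    have Ux : U [set w | (x < w)%N] by apply: ooU; exists x.+1.
    have Ucx := Ucol x; rewrite sa ?mem_head // in Ucx.
    have {}IH := IH (fun y ys => sa y (mem_behead (s:=x::s) ys)).
    apply: filterS (filterI (filterI Ux Ucx) IH) => w [[xw cw] sw] y.
    by rewrite in_cons => /predU1P[->//|/sw].
  by move=> /(filterI Ua)/filter_ex[w [? ?]]; exists w.
exists f, a => i j lt_ij; apply: (fQ j).2.
by apply/mapP; exists i; rewrite // mem_iota.
Qed.

(** * Linear orders containing a copy of the rationals *)

Lemma strict_linear_order_flip (T : Type) (lt : T -> T -> Prop) :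
  strict_linear_order lt -> strict_linear_order (fun x y => lt y x).
Proof.
case=> irr trans total; split=> [//|x y z xy yz|x y]; first exact: trans yz xy.
by case: (total x y) => H; [apply: Or33|apply: Or32|apply: Or31].
Qed.

(** Counting [u] as a candidate guarantees a maximum even if [A] selects nothing. [A] speaks of
    positions because the selection will go by the rational attached to a position. *)
Lemma max_of_list (T : Type) (lt : T -> T -> Prop) (u : T) (s : seq T)
    (A : nat -> Prop) : strict_linear_order lt ->
  exists a, [/\ a = u \/ (exists2 i, (i < size s)%N & A i /\ a = nth u s i),
    u = a \/ lt u a &
    forall i, (i < size s)%N -> A i -> nth u s i = a \/ lt (nth u s i) a].
Proof.
case=> _ lt_trans lt_total.
elim/last_ind: s => [|s x [a [aE ua amax]]].
  by exists u; split => //; left.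
have aE' : a = u \/
    (exists2 i, (i < size (rcons s x))%N & A i /\ a = nth u (rcons s x) i).
  case: aE => [|[i lti [Ai aE]]]; [by left|right; exists i].
    by rewrite size_rcons ltnW.
  by rewrite nth_rcons lti.
have step b : (b = u \/
    (exists2 i, (i < size (rcons s x))%N & A i /\ b = nth u (rcons s x) i)) ->
    (a = b \/ lt a b) -> (A (size s) -> x = b \/ lt x b) ->
    exists a, [/\ a = u \/ (exists2 i, (i < size (rcons s x))%N
                       & A i /\ a = nth u (rcons s x) i),
      u = a \/ lt u a &
      forall i, (i < size (rcons s x))%N -> A i ->
        nth u (rcons s x) i = a \/ lt (nth u (rcons s x) i) a].
  move=> bE ab xb; exists b; split => // [|i].
    case: ab => [<- //|ab].
    by case: ua => [->|ua]; right; [|exact: lt_trans ua ab].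
  rewrite size_rcons ltnS leq_eqVlt nth_rcons => /predU1P[->|lti Ai].
    by rewrite ltnn eqxx.
  rewrite lti; have := amax i lti Ai; case: ab => [<- //|ab].
  by case=> [->|ia]; right; [|exact: lt_trans ia ab].
have [Ax|nAx] := pselect (A (size s)); last first.
  by apply: (step a) => //; left.
have [ax|ax|xa] := lt_total a x.
- apply: (step x); [right; exists (size s) | by right | by left].
    by rewrite size_rcons.
  by rewrite nth_rcons ltnn eqxx.
- by apply: (step a) => //; left.
- by apply: (step a) => //; [left|right].
Qed.

(** Cantor's argument: the rationals are placed one by one between [u] and [v], keeping [P] between
    any two of them so that every gap can be subdivided again. *)
Lemma not_scattered_of_dense (T : Type) (lt P : T -> T -> Prop) (u v : T) :
    strict_linear_order lt ->
    (forall a b, P a b -> lt a b) ->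
    (forall a b c, lt a b -> P b c -> P a c) ->
    (forall a b c, P a b -> lt b c -> P a c) ->
    (forall a b, P a b -> exists2 w, P a w & P w b) ->
    P u v -> ~ scattered lt.
Proof.
move=> lt_order P_lt P_ltl P_ltr P_dense Puv.
have [irr trans total] := lt_order.
(* Indices that code no rational repeat the value 0; this is harmless, since [Q] relates only
   positions with distinct values of [q]. *)
pose q (i : nat) : rat := odflt 0%R (choice.unpickle i).
pose Q (s : seq T) (w : T) := [/\ P u w, P w v,
  forall i, (i < size s)%N -> (q i < q (size s))%R -> P (nth u s i) w &
  forall i, (i < size s)%N -> (q (size s) < q i)%R -> P w (nth u s i)].
have [s sQ|g gQ] := @history_choice _ Q.
  have Qnth i : (i < size s)%N -> Q (take i s) (nth u s i) by exact: sQ.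
  have sizei i : (i < size s)%N -> size (take i s) = i.
    by move=> lti; rewrite size_takel // ltnW.
  have Pu i : (i < size s)%N -> P u (nth u s i) by case/Qnth.
  have Pv i : (i < size s)%N -> P (nth u s i) v by case/Qnth.
  have Ps i j : (i < size s)%N -> (j < size s)%N -> (q i < q j)%R ->
      P (nth u s i) (nth u s j).
    move=> lti ltj; have [ij|ji|->] := ltngtP i j;
    last by rewrite Order.POrderTheory.ltxx.
      by have [_ _ + _] := Qnth j ltj; rewrite sizei // => /(_ i ij); rewrite nth_take.
    by have [_ _ _] := Qnth i lti; rewrite sizei // => /(_ j ji); rewrite nth_take.
  (* [a] and [b] are the nearest earlier points below and above the new one, or else the ends [u]
     and [v]. *)
  have [a [aE ua amax]] := max_of_list u s (fun i => (q i < q (size s))%R) lt_order.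
  have [b [bE vb bmin]] := max_of_list v s (fun i => (q (size s) < q i)%R)
    (strict_linear_order_flip lt_order).
  have nthv i : (i < size s)%N -> nth v s i = nth u s i by exact: set_nth_default.
  have Pab : P a b.
    case: aE => [->|[i lti [qi ->]]]; case: bE => [->|[j ltj [qj ->]]] //.
    + by rewrite nthv //; exact: Pu.
    + exact: Pv.
    + by rewrite nthv //; apply: Ps => //; exact: Order.POrderTheory.lt_trans qi qj.
  have [w aw wb] := P_dense _ _ Pab; exists w; split.
  - by case: ua => [->//|ua]; exact: P_ltl ua aw.
  - by case: vb => [->//|vb]; exact: P_ltr wb vb.
  - by move=> i lti qi; case: (amax i lti qi) => [->//|ia]; exact: P_ltl ia aw.
  - move=> i lti qi; rewrite -nthv //.
    by case: (bmin i lti qi) => [->//|ib]; exact: P_ltr wb ib.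
have qg i j : (q i < q j)%R -> P (g i) (g j).
  have [_ _ gl _] := gQ j; have [_ _ _ gr] := gQ i.
  rewrite !size_mkseq in gl gr.
  have [ij|ji|->] := ltngtP i j;
    last by rewrite Order.POrderTheory.ltxx.
    by move=> qij; have := gl i ij qij; rewrite nth_mkseq.
  by move=> qij; have := gr j ji qij; rewrite nth_mkseq.
have qK x : q (choice.pickle x) = x by rewrite /q choice.pickleK.
have mono (x y : rat) : (x < y)%R -> lt (g (choice.pickle x)) (g (choice.pickle y)).
  by move=> xy; apply/P_lt/qg; rewrite !qK.
apply; exists (fun x => g (choice.pickle x)); split=> [x y|x y].
  by case: (Order.TotalTheory.ltgtP x y) => // /mono + e; rewrite e => /irr.
split=> [/mono //|]; case: (Order.TotalTheory.ltgtP x y) => // [/mono yx xy|->/irr//].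
by have := irr _ (trans _ _ _ xy yx).
Qed.

(** * Large sets, their finite unions and their intervals *)

Fixpoint large (T : Type) (lt : T -> T -> Prop) (k : nat) (X : set T) : Prop :=
  if k is k'.+1 then
    exists F : nat -> set T, (forall i, F i `<=` X /\ large lt k' (F i)) /\
      forall i j x y, (i < j)%N -> F i x -> F j y -> lt x y
  else X !=set0.

Section Big.
Variables (T : Type) (lt : T -> T -> Prop).

Lemma large_rel (T' : Type) (lt' : T' -> T' -> Prop) (phi : T -> T' -> Prop)
    (X : set T) k :
    (forall x, X x -> exists x', phi x x') ->
    (forall x x' y y', X x -> X y -> phi x x' -> phi y y' -> lt x y -> lt' x' y') ->
  large lt k X -> large lt' k [set x' | exists2 x, X x & phi x x'].
Proof.
elim: k X => [|k IH] X ex mono /=.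
  by move=> [x Xx]; have [x' xx'] := ex x Xx; exists x', x.
move=> [F [FX Flt]]; exists (fun i => [set x' | exists2 x, F i x & phi x x']).
split=> [i|i j x' y' ij [x Fx xx'] [y Fy yy']]; last first.
  exact: mono ((FX i).1 _ Fx) ((FX j).1 _ Fy) xx' yy' (Flt _ _ _ _ ij Fx Fy).
have [FiX Fibig] := FX i; split=> [x' [x /FiX Xx xx']|]; first by exists x.
apply: IH Fibig => [x /FiX /ex //|x x' y y' /FiX Xx /FiX Xy].
exact: mono.
Qed.

Lemma large_subset k (X Y : set T) : X `<=` Y -> large lt k X -> large lt k Y.
Proof.
case: k => [|k] XY /=; first by move=> [x /XY]; exists x.
move=> [F [FX Flt]]; exists F; split=> // i.
by have [FiX ?] := FX i; split=> // x /FiX /XY.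
Qed.

Lemma large_pred k (X : set T) : large lt k.+1 X -> large lt k X.
Proof. by move=> [F [/(_ 0%N)[FX bF] _]]; apply: large_subset bF. Qed.

Lemma large_le k l (X : set T) : (k <= l)%N -> large lt l X -> large lt k X.
Proof. by move=> /subnK <-; elim: (l - k)%N => //= d IH /large_pred. Qed.

Lemma large_nonempty k (X : set T) : large lt k X -> X !=set0.
Proof. exact: large_le (leq0n k). Qed.

(** By induction each [F i] is large within [X] or within [Y]. If this happens for [X] at
    arbitrarily late indices, a subsequence shows that [X] is large; otherwise all late indices
    serve [Y]. *)
Lemma large_setU k (X Y : set T) :
  large lt k (X `|` Y) -> large lt k X \/ large lt k Y.
Proof.
elim: k X Y => [|k IH] X Y /=; first by move=> [x []]; [left|right]; exists x.
move=> [F [FXY Flt]].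
have Fi i : large lt k (F i `&` X) \/ large lt k (F i `&` Y).
  by have [FiXY] := FXY i; move/setIidPl: (FiXY) => {1}<-; rewrite setIUr => /IH.
have sub Z : (forall n, exists2 i, (n < i)%N & large lt k (F i `&` Z)) ->
    large lt k.+1 Z.
  move=> Zio; pose Q (s : seq nat) i :=
    large lt k (F i `&` Z) /\ forall j, j \in s -> (j < i)%N.
  have [s _|g gQ] := @history_choice _ Q.
    have [i mi bi] := Zio (\max_(j <- s) j); exists i; split=> // j js.
    exact: leq_ltn_trans (leq_bigmax_seq _ js isT) mi.
  exists (fun n => F (g n) `&` Z); split=> [n|i j x y ij [Fx _] [Fy _]].
    by split; [move=> x []|case: (gQ n)].
  apply: Flt Fx Fy; apply: (gQ j).2.
  by apply/mapP; exists i; rewrite // mem_iota.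
have [Xio|/existsNP[n nX]] :=
  pselect (forall n, exists2 i, (n < i)%N & large lt k (F i `&` X)).
  by left; apply: sub.
right; apply: sub => m; exists (maxn m n).+1; first by rewrite ltnS leq_maxl.
case: (Fi (maxn m n).+1) => // bX; case: nX; exists (maxn m n).+1 => //.
by rewrite ltnS leq_maxr.
Qed.

Lemma large_bigcup k (I : eqType) (s : seq I) (Z : I -> set T) :
  large lt k [set x | exists2 i, i \in s & Z i x] -> exists i, large lt k (Z i).
Proof.
elim: s => [|i s IH]; first by move=> /large_nonempty[x []].
move=> bs; suff /large_setU[|/IH //] :
    large lt k (Z i `|` [set x | exists2 i, i \in s & Z i x]) by exists i.
apply: large_subset bs => x [j]; rewrite in_cons => /predU1P[->|js Zx]; first by left.
by right; exists j.
Qed.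

Lemma large_below k (X : set T) :
  large lt k.+1 X -> exists2 y, X y & large lt k [set x | X x /\ lt x y].
Proof.
move=> [F [FX Flt]]; have [FX0 b0] := FX 0%N; have [FX1 b1] := FX 1%N.
have [y F1y] := large_nonempty b1; exists y; first exact: FX1.
apply: large_subset b0 => x F0x; split; first exact: FX0.
exact: Flt F0x F1y.
Qed.

(** Dropping the first set leaves an infinite sequence, so no degree is lost above a point; below a
    point only one member of the sequence is sure to remain, which costs a degree. *)
Lemma large_above k (X : set T) :
  large lt k.+1 X -> exists2 y, X y & large lt k.+1 [set x | X x /\ lt y x].
Proof.
move=> [F [FX Flt]]; have [FX0 b0] := FX 0%N.
have [y F0y] := large_nonempty b0; exists y; first exact: FX0.
exists (fun i => F i.+1); split=> [i|i j x z ij]; last exact: Flt.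
have [FXi bi] := FX i.+1; split=> // x Fx; split; first exact: FXi.
exact: Flt F0y Fx.
Qed.

Hypothesis lt_order : strict_linear_order lt.

Definition open_interval u v : set T := [set x | lt u x /\ lt x v].

Lemma large_subsingleton k (X : set T) :
  (forall x y, X x -> X y -> x = y) -> ~ large lt k.+1 X.
Proof.
move=> X1 [F [FX Flt]]; have [FX0 b0] := FX 0%N; have [FX1 b1] := FX 1%N.
have [x F0x] := large_nonempty b0; have [y F1y] := large_nonempty b1.
have := Flt _ _ _ _ (ltn0Sn 0) F0x F1y.
by rewrite (X1 x y (FX0 _ F0x) (FX1 _ F1y)); case: lt_order => + _ _ => /[apply].
Qed.

Lemma large_interval k (X : set T) :
  large lt k.+2 X -> exists u v, large lt k (open_interval u v).
Proof.
move=> /large_below[v Xv /large_above[u [Xu uv] b]]; exists u, v.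
by apply: large_subset (large_pred b) => x [[]].
Qed.

(* If every point split off a small part on one side, the interval would be the
   union of a set with small initial and one with small final segments. *)
Lemma large_interval_split N u v : large lt N.+2 (open_interval u v) ->
  exists2 w, open_interval u v w &
    large lt N.+1 (open_interval u w) /\ large lt N.+1 (open_interval w v).
Proof.
move=> buv; apply: contrapT => nw.
have : large lt N.+2
   ([set w | open_interval u v w /\ ~ large lt N.+1 (open_interval u w)] `|`
    [set w | open_interval u v w /\ ~ large lt N.+1 (open_interval w v)]).
  apply: large_subset buv => w uvw; apply: contrapT => /not_orP[nl nr].
  by apply: nw; exists w => //; split; apply: contrapT => ?; [apply: nl|apply: nr].
case/large_setU => [/large_below[y [uvy nb] b]|/large_above[y [uvy nb] b]]; apply: nb.
  by apply: large_subset b => x [[[ux _] _]].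
by apply: large_pred; apply: large_subset b => x [[[_ xv] _]].
Qed.

(** Under the second hypothesis, [N.+1]-large intervals are large at every level, so splitting one
    gives two of the same kind: they form the dense relation [P]. *)
Lemma scattered_bounded N : scattered lt ->
    (forall u v, large lt N.+1 (open_interval u v) ->
       forall k, large lt k (open_interval u v)) ->
  exists k, ~ large lt k [set: T].
Proof.
move=> sc stab; apply: contrapT => /forallNP allbig.
have /large_interval[u [v buv]] : large lt N.+3 [set: T] by apply: contrapT (allbig _).
have [irr trans total] := lt_order.
pose P a b := lt a b /\ large lt N.+1 (open_interval a b).
apply: (@not_scattered_of_dense _ lt P u v) sc => //.
- by move=> a b [].
- move=> a b c ab [bc b1]; split; first exact: trans ab bc.
  by apply: large_subset b1 => x [bx xc]; split=> //; exact: trans ab bx.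
- move=> a b c [ab b1] bc; split; first exact: trans ab bc.
  by apply: large_subset b1 => x [ax xb]; split=> //; exact: trans xb bc.
- move=> a b [ab b1].
  by have [w [aw wb] [baw bwb]] := large_interval_split (stab _ _ b1 N.+2); exists w.
- split=> //; have [w [uw wv]] := large_nonempty buv; exact: trans uw wv.
Qed.

End Big.

(** * Convolutions of words *)

Section WordConvolution.
Variable A : finType.
Implicit Types u v p : seq A.

Let mkseq_consE (B : Type) (f : nat -> B) n :
  mkseq f n.+1 = f 0%N :: mkseq (fun i => f i.+1) n.
Proof. by rewrite /mkseq /= (iotaDl 1 0) -map_comp. Qed.

Lemma word_conv_cons a b u v :
  word_conv (a :: u) (b :: v) = (Some a, Some b) :: word_conv u v.
Proof. by rewrite /word_conv /= maxnSS mkseq_consE. Qed.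

Lemma word_conv0l v : word_conv [::] v = [seq (None, Some b) | b <- v].
Proof.
elim: v => [//|b v IH]; rewrite /word_conv /= max0n mkseq_consE /= -IH.
by rewrite /word_conv max0n; congr cons; apply: eq_mkseq => -[].
Qed.

Lemma word_conv0r u : word_conv u [::] = [seq (Some a, None) | a <- u].
Proof.
elim: u => [//|a u IH]; rewrite /word_conv /= maxn0 mkseq_consE /= -IH.
by rewrite /word_conv maxn0; congr cons; apply: eq_mkseq => -[].
Qed.

Lemma word_conv_cat p p' u v : size p = size p' ->
  word_conv (p ++ u) (p' ++ v) = word_conv p p' ++ word_conv u v.
Proof.
elim: p p' => [|a p IH] [|a' p'] //= [eq_sz].
by rewrite !word_conv_cons IH.
Qed.

(** Once [u] has ended, the rest of the input depends on [v] alone, so the state reached on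
    [word_conv u p] is all that an automaton needs to know about [u] and [p]. *)
Lemma word_conv_catl u p v : (size u <= size p)%N ->
  word_conv u (p ++ v) = word_conv u p ++ [seq (None, Some b) | b <- v].
Proof.
elim: u p => [|a u IH] [|b p] // le_up; rewrite ?word_conv0l -?map_cat //.
by rewrite !cat_cons !word_conv_cons IH.
Qed.

Lemma word_conv_catr u p v : (size v <= size p)%N ->
  word_conv (p ++ u) v = word_conv p v ++ [seq (Some a, None) | a <- u].
Proof.
elim: v p => [|b v IH] [|a p] // le_vp; rewrite ?word_conv0r -?map_cat //.
by rewrite !cat_cons !word_conv_cons IH.
Qed.

(** Deleting the padding from either track with [pmap] recovers the word. *)
Lemma word_conv_inj u v u' v' :
  word_conv u v = word_conv u' v' -> u = u' /\ v = v'.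
Proof.
have pmapS (B C : Type) (h : A -> B) (f : B -> option C) (g : A -> C) x :
    (forall a, f (h a) = Some (g a)) -> pmap f (map h x) = map g x.
  by move=> fh; elim: x => //= a x ->; rewrite fh.
have pmapN (B C : Type) (h : A -> B) (f : B -> option C) x :
    (forall a, f (h a) = None) -> pmap f (map h x) = [::].
  by move=> fh; elim: x => //= a x ->; rewrite fh.
have fstE (x y : seq A) : pmap fst (word_conv x y) = x.
  elim: x y => [|a x IH] [|b y]; rewrite ?word_conv0l ?word_conv0r ?word_conv_cons //.
  - by rewrite pmapN.
  - by rewrite (pmapS _ _ _ _ id) ?map_id.
  - by rewrite /= IH.
have sndE (x y : seq A) : pmap snd (word_conv x y) = y.
  elim: y x => [|b y IH] [|a x]; rewrite ?word_conv0l ?word_conv0r ?word_conv_cons //.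
  - by rewrite pmapN.
  - by rewrite (pmapS _ _ _ _ id) ?map_id.
  - by rewrite /= IH.
by move=> e; rewrite -(fstE u v) -{2}(sndE u v) e fstE sndE.
Qed.

End WordConvolution.

(** * Boundedness of scattered word automatic orders *)

Definition run_word (A : finType) (M : dfa A) (w : seq A) : dfa_state M :=
  foldl (@dfa_step A M) (dfa_init M) w.

Section WordAutomatic.
Variables (T : Type) (lt : T -> T -> Prop).
Hypothesis lt_order : strict_linear_order lt.
Hypothesis lt_scattered : scattered lt.
Variables (A : finType) (M : dfa A) (M2 : dfa (option A * option A)%type).
Variable enc : T -> seq A.
Hypothesis enc_inj : injective enc.
Hypothesis encP : forall w, dfa_accepts M w <-> exists x, enc x = w.
Hypothesis ltP : forall x y,
  lt x y <-> dfa_accepts M2 (word_conv (enc x) (enc y)).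

Let cylinder p : set T := [set x | exists y, enc x = p ++ y].

(** The prefix grows letter by letter: at most one element has code exactly [p], which is too little
    to be large, and the others fall into finitely many longer cylinders. *)
Let large_cylinder N (X : set T) n :
  large lt N.+1 X -> exists2 p, size p = n & large lt N.+1 (X `&` cylinder p).
Proof.
move=> bX; elim: n => [|n [p szp bp]].
  by exists [::] => //; apply: large_subset bX => x Xx; split=> //; exists (enc x).
have : large lt N.+1 ([set x | enc x = p] `|` [set x | exists2 a, a \in enum A &
    (X `&` cylinder (rcons p a)) x]).
  apply: large_subset bp => x [Xx [[|a y] xE]]; [left|right].
    by rewrite /= xE cats0.
  exists a; first by rewrite mem_enum.
  by split=> //; exists y; rewrite cat_rcons.
move=> /large_setU[|/large_bigcup[a b]]; last first.
  by exists (rcons p a); rewrite ?size_rcons ?szp.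
move=> /(large_subsingleton lt_order)[] x y /= xp yp.
by apply: enc_inj; rewrite xp yp.
Qed.

(* Everything that the automata remember about the elements of the interval
   between [u] and [v] whose code begins with [p]. *)
Let piece_type u v p :=
  (run_word M p, run_word M2 (word_conv p p),
   run_word M2 (word_conv (enc u) p), run_word M2 (word_conv p (enc v))).

Let small_ends u v (p : seq A) :=
  (size (enc u) <= size p)%N && (size (enc v) <= size p)%N.

(** Exchanging the prefix [p] for [p'] and keeping the suffix preserves membership, comparisons
    inside the piece, and comparisons with the two ends, since the four states agree. *)
Let large_piece_type k u v p u' v' p' :
    small_ends u v p -> small_ends u' v' p' ->
    piece_type u v p = piece_type u' v' p' ->
  large lt k (open_interval lt u v `&` cylinder p) ->
  large lt k (open_interval lt u' v' `&` cylinder p').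
Proof.
move=> /andP[szu szv] /andP[szu' szv']; rewrite /piece_type => -[eM eM2 eu ev].
move=> /(@large_rel _ _ _ lt
  (fun x x' => exists y, enc x = p ++ y /\ enc x' = p' ++ y)).
have runE (B : finType) (N : dfa B) w w' z : run_word N w = run_word N w' ->
    dfa_accepts N (w ++ z) = dfa_accepts N (w' ++ z).
  by rewrite /run_word /dfa_accepts !foldl_cat => ->.
move=> b; apply: large_subset (b _ _) => [x' [x [[ux xv] _] [y [xE x'E]]]||].
- split; last by exists y.
  move: ux xv; rewrite /open_interval /= !ltP xE x'E.
  rewrite !word_conv_catl // !word_conv_catr //.
  by rewrite (runE _ _ _ _ _ eu) (runE _ _ _ _ _ ev).
- move=> x [_ [y xE]].
  have /encP[x' x'E] : dfa_accepts M (p' ++ y).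
    by rewrite -(runE _ _ _ _ _ eM); apply/encP; exists x.
  by exists x', y.
- move=> x x' z z' _ _ [y [xE x'E]] [t [zE z'E]].
  by rewrite !ltP xE x'E zE z'E !word_conv_cat // (runE _ _ _ _ _ eM2).
Qed.

Lemma word_presentation_bounded : exists k, ~ large lt k [set: T].
Proof.
(* There are finitely many piece types, so the levels of largeness they attain stabilize at a common
   [N]. *)
pose P a k := exists u v p, [/\ small_ends u v p, piece_type u v p = a &
  large lt k (open_interval lt u v `&` cylinder p)].
have [a k [u [v [p [sz ty /large_pred b]]]]|N Nstab] := @antitone_stabilizes _ P.
  by exists u, v, p.
apply: (@scattered_bounded _ _ lt_order N) => // u v buv k.
have [p szp bp] := large_cylinder (maxn (size (enc u)) (size (enc v))) buv.
have sm : small_ends u v p by rewrite /small_ends szp leq_maxl leq_maxr.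
have [|u' [v' [p' [sm' ty b]]]] := Nstab (piece_type u v p) _ k.
  by exists u, v, p; split=> //; apply: large_pred.
by apply: large_subset (large_piece_type sm' sm ty b) => x [].
Qed.

End WordAutomatic.

Lemma scattered_flip (T : Type) (lt : T -> T -> Prop) :
  scattered lt -> scattered (fun x y => lt y x).
Proof.
move=> sc [f [finj flt]]; apply: sc; exists (fun x => f (- x)%R); split.
  by move=> x y /finj /GRing.oppr_inj.
by move=> x y; rewrite -flt Num.Theory.ltrN2.
Qed.

Lemma word_automatic_bounded (T : Type) (lt : T -> T -> Prop) :
    strict_linear_order lt -> scattered lt -> word_automatic lt ->
  exists k, ~ large lt k [set: T] /\ ~ large (fun x y => lt y x) k [set: T].
Proof.
move=> lt_order sc [A [W [R [[M WE] [M2 RE] [f [g fK gK] fR]]]]].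
pose enc x : seq A := val (f x).
have enc_inj : injective enc by move=> x y /val_inj /(can_inj fK).
have encP w : dfa_accepts M w <-> exists x, enc x = w.
  split=> [acc|[x <-]].
    have Ww : w \in W by rewrite inE WE.
    by exists (g (exist _ w Ww)); rewrite /enc gK.
  by have := set_valP (f x); rewrite {1}WE.
have ltE x y : lt x y <-> dfa_accepts M2 (word_conv (enc x) (enc y)).
  split=> [/fR Rxy|acc].
    suff : [set w | dfa_accepts M2 w] (word_conv (enc x) (enc y)) by [].
    by rewrite -RE; exists (f x), (f y).
  have : [set w | dfa_accepts M2 w] (word_conv (enc x) (enc y)) by [].
  rewrite -RE => -[u [v [Ruv /word_conv_inj[/val_inj xu /val_inj yv]]]].
  by apply/fR; rewrite xu yv.
(* [M2'] reads the two tracks exchanged and thus presents the converse order. *)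
pose M2' := @Dfa _ (dfa_state M2) (dfa_init M2)
  (fun q (a : option A * option A) => dfa_step q (a.2, a.1)) (dfa_final M2).
have ltE' x y : lt y x <-> dfa_accepts M2' (word_conv (enc x) (enc y)).
  have swap : word_conv (enc y) (enc x) =
      [seq (a.2, a.1) | a <- word_conv (enc x) (enc y)].
    by rewrite /word_conv maxnC /mkseq -map_comp.
  rewrite ltE swap /dfa_accepts /=.
  by elim: (word_conv _ _) (dfa_init M2) => //= a w IH q.
have [k kP] := word_presentation_bounded lt_order sc enc_inj encP ltE.
have [l lP] := word_presentation_bounded (strict_linear_order_flip lt_order)
  (scattered_flip sc) enc_inj encP ltE'.
exists (maxn k l); split; last by move/(large_le (leq_maxr k l)).
by move/(large_le (leq_maxl k l)).
Qed.

(** * Orders on vectors that depend only on signs of differences *)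

Definition same_signs m (i j i' j' : nat -> nat) : Prop :=
  forall k, (k < m)%N ->
    ((i k < j k)%N = (i' k < j' k)%N) * ((j k < i k)%N = (j' k < i' k)%N).

Definition update (i : nat -> nat) c n : nat -> nat :=
  fun k => if k == c then n else i k.

(* A linear order on [nat ^ m] in which the comparison of two vectors depends
   only on the signs of the differences of their coordinates is lexicographic,
   for some priority of the coordinates and up to reversing some of them. *)
Section SignOrder.
Variables (m : nat) (R : (nat -> nat) -> (nat -> nat) -> Prop).
Hypothesis R_sign : forall i j i' j',
  same_signs m i j i' j' -> R i j -> R i' j'.
Hypothesis R_trans : forall i j l, R i j -> R j l -> R i l.
Hypothesis R_total : forall i j k, (k < m)%N -> i k <> j k -> R i j \/ R j i.

Definition unit_vector (c : nat) : nat -> nat := fun k => k == c.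
Definition increasing_in c : Prop := R (fun=> 0%N) (unit_vector c).

Let dominates c (K : seq nat) : Prop := forall i j,
  (forall k, (k < m)%N -> k \notin c :: K -> i k = j k) -> (i c < j c)%N -> R i j.

Let dominates_sub c K K' : {subset K' <= c :: K} -> dominates c K -> dominates c K'.
Proof.
move=> sub dom i j eq_ij; apply: dom => k km kcK; apply: eq_ij => //.
apply: contra kcK; rewrite !in_cons => /predU1P[->|/sub]; first by rewrite eqxx.
by rewrite in_cons.
Qed.

Let dominates0 c : increasing_in c -> dominates c [::].
Proof.
move=> inc i j eq_ij lt_ij; apply: R_sign inc => k km; rewrite /unit_vector.
have [->|kc] := eqVneq k c; first by rewrite lt_ij (leq_gtF (ltnW lt_ij)).
by rewrite eq_ij ?inE // ltnn.
Qed.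

(** If [d] increases too, the coordinates are changed one at a time; if [d] decreases, the sign
    pattern is that of the two unit vectors; if [d] is fixed, only [c] matters. *)
Let dominates1 c d : c != d -> increasing_in c -> increasing_in d ->
  R (unit_vector d) (unit_vector c) -> dominates c [:: d].
Proof.
move=> cd incc incd Rdc i j eq_ij lt_ij.
have [lt_d|lt_d|eq_d] := ltngtP (i d) (j d).
- apply: (@R_trans _ (update i c (j c))).
    apply: dominates0 incc _ _ _ _ => [k _|]; rewrite /update ?eqxx //.
    by rewrite !inE => /negPf->.
  apply: dominates0 incd _ _ _ _ => [k km|]; rewrite /update.
    rewrite !inE => kd; have [->//|kc] := eqVneq k c.
    by apply: eq_ij; rewrite // !inE negb_or kc.
  by rewrite eq_sym (negPf cd).
- apply: R_sign Rdc => k km; rewrite /unit_vector.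
  have [->|kc] := eqVneq k c; first by rewrite (negPf cd) lt_ij (leq_gtF (ltnW lt_ij)).
  have [->|kd] := eqVneq k d; first by rewrite lt_d (leq_gtF (ltnW lt_d)).
  by rewrite eq_ij ?ltnn // !inE negb_or kc.
- apply: dominates0 incc _ _ _ lt_ij => k km; rewrite !inE => kc.
  by have [->//|kd] := eqVneq k d; apply: eq_ij; rewrite // !inE negb_or kc.
Qed.

(* Comparisons are unchanged when the dominating coordinate of the larger
   vector is raised, which makes room for intermediate vectors. *)
Let R_raise i j c : (i c < j c)%N -> R i (update j c (j c).+1) -> R i j.
Proof.
move=> lt_c; apply: R_sign => k km; rewrite /update.
have [->|//] := eqVneq k c; rewrite lt_c (leqW lt_c).
by rewrite (leq_gtF (ltnW lt_c)) (leq_gtF (leqW (ltnW lt_c))).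
Qed.

(** Two increases of [c] are used: the first brings [d] to its target, the second the coordinates in
    [K]. *)
Let dominates_consr c d K : c != d ->
  dominates c [:: d] -> dominates c K -> dominates c (d :: K).
Proof.
move=> cd domcd domK i j eq_ij lt_ij; apply: (R_raise lt_ij).
apply: (@R_trans _ (update (update i d (j d)) c (j c))).
  apply: domcd => [k _|]; rewrite /update ?eqxx // !inE negb_or.
  by case/andP=> /negPf-> /negPf->.
apply: domK => [k km|]; rewrite /update ?eqxx // !inE negb_or.
case/andP=> /[dup] kc /negPf-> kK; have [->//|kd] := eqVneq k d.
by apply: eq_ij; rewrite // !inE !negb_or kc kd.
Qed.

(** Two increases of [d] enclose one of [c]: the first resets [c] to 0, then [c] rises to 1 while
    [K] reaches its target, and the last sets [c] to its target. *)
Let dominates_consl c d K : c != d ->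
  dominates d [:: c] -> dominates c K -> dominates d (c :: K).
Proof.
move=> cd domdc domK i j eq_ij lt_ij; apply: (R_raise lt_ij).
apply: (@R_trans _ (update (update i d (j d)) c 0)).
  apply: domdc => [k _|]; rewrite /update ?eqxx // 1?[d == c]eq_sym ?(negPf cd) //.
  by rewrite !inE negb_or; case/andP=> /negPf-> /negPf->.
apply: (@R_trans _ (update j c 1)).
  apply: domK => [k km|]; rewrite /update ?eqxx // !inE negb_or.
  case/andP=> /[dup] kc /negPf-> kK; have [->//|kd] := eqVneq k d.
  by apply: eq_ij; rewrite // !inE !negb_or kc kd.
apply: domdc => [k _|]; rewrite /update ?eqxx // 1?[d == c]eq_sym ?(negPf cd) //.
by rewrite !inE negb_or; case/andP=> /negPf-> /negPf->.
Qed.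

(** Each new coordinate [d] is matched against the dominating [c] of the others; comparing their
    unit vectors decides which one prevails. *)
Let exists_dominating K : uniq K -> K != [::] ->
    (forall k, k \in K -> (k < m)%N /\ increasing_in k) ->
  exists2 c, c \in K & dominates c K.
Proof.
elim: K => // d K IH /= /andP[dK uK] _ Kinc.
have [dm dinc] := Kinc d (mem_head d K).
have [K0|K_neq0] := eqVneq K [::].
  exists d; rewrite ?mem_head // K0.
  by apply: (dominates_sub _ (dominates0 dinc)).
have [|c cK domc] := IH uK K_neq0.
  by move=> k kK; apply: Kinc; rewrite in_cons kK orbT.
have [cm cinc] : (c < m)%N /\ increasing_in c.
  by apply: Kinc; rewrite in_cons cK orbT.
have cd : c != d by apply: contraNneq dK => <-.
have dc : d != c by rewrite eq_sym.
have [|Rdc|Rcd] := @R_total (unit_vector d) (unit_vector c) c cm.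
- by rewrite /unit_vector eqxx (negPf cd).
- exists c; first by rewrite in_cons cK orbT.
  by apply: dominates_consr => //; apply: dominates1.
- exists d; first exact: mem_head.
  apply: (@dominates_sub _ (c :: K)).
    by move=> k; rewrite !in_cons => /orP[->//|->]; rewrite !orbT.
  by apply: dominates_consl => //; apply: dominates1.
Qed.

Lemma large_increasing K : uniq K ->
    (forall k, k \in K -> (k < m)%N /\ increasing_in k) ->
  forall i0, large R (size K) [set i | forall k, k \notin K -> i k = i0 k].
Proof.
move: {2}(size K) (erefl (size K)) => n; elim: n K => [|n IH] K szK uK Kinc i0.
  by rewrite szK; exists i0.
have [|c cK domc] := exists_dominating uK _ Kinc; first by case: K szK {uK Kinc}.
have Kr k : k \notin K -> k \notin rem c K.
  by apply: contra; exact: mem_rem.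
have crem : c \notin rem c K by rewrite mem_rem_uniq // !inE eqxx.
(* The slices are given by the value [a] of the dominating coordinate; within a slice the remaining
   coordinates of [K] vary. *)
rewrite szK; exists (fun a =>
  [set i | forall k, k \notin rem c K -> i k = update i0 c a k]).
split=> [a|a b x y ab xF yF].
  split=> [i iF k kK|].
    rewrite iF ?Kr // /update; case: eqVneq => // kc.
    by rewrite kc cK in kK.
  have szr : size (rem c K) = n by rewrite size_rem // szK.
  rewrite -szr; apply: IH => //; first exact: rem_uniq.
  by move=> k /mem_rem; apply: Kinc.
apply: domc => [k km kcK|]; last by rewrite xF // yF // /update eqxx.
move: kcK; rewrite in_cons negb_or => /andP[/negPf kc kK].
by rewrite xF ?yF ?Kr // /update kc.
Qed.

End SignOrder.

(** A coordinate that is not increasing for [R] is increasing for its converse, and one of the two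
    groups contains at least [n] coordinates. *)
Lemma sign_order_large m n (R : (nat -> nat) -> (nat -> nat) -> Prop) :
    (n.*2 <= m)%N ->
    (forall i j i' j', same_signs m i j i' j' -> R i j -> R i' j') ->
    (forall i j l, R i j -> R j l -> R i l) ->
    (forall i j k, (k < m)%N -> i k <> j k -> R i j \/ R j i) ->
  large R n [set: nat -> nat] \/ large (fun i j => R j i) n [set: nat -> nat].
Proof.
move=> le_nm R_sign R_trans R_total; pose R' i j := R j i.
pose K := [seq k <- iota 0 m | `[< increasing_in R k >]].
pose K' := [seq k <- iota 0 m | ~~ `[< increasing_in R k >]].
have sz : (size K + size K')%N = m.
  by rewrite !size_filter count_predC size_iota.
have uK : uniq K by rewrite filter_uniq ?iota_uniq.
have uK' : uniq K' by rewrite filter_uniq ?iota_uniq.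
have KP k : k \in K -> (k < m)%N /\ increasing_in R k.
  by rewrite mem_filter mem_iota => /andP[/asboolP].
have KP' k : k \in K' -> (k < m)%N /\ increasing_in R' k.
  rewrite mem_filter mem_iota => /andP[/asboolPn ninc km]; split=> //.
  have [|//|//] := R_total (fun=> 0%N) (unit_vector k) k km.
  by rewrite /unit_vector eqxx.
have [nK|nK] : (n <= size K)%N \/ (n <= size K')%N.
  have [?|Kn] := leqP n (size K); [by left|right].
  by rewrite -(leq_add2l n) addnn (leq_trans le_nm) // -sz leq_add2r ltnW.
- left; have lK := large_increasing R_sign R_trans R_total uK KP (fun=> 0%N).
  by have := large_le nK lK; exact: large_subset.
- have R'_sign i j i' j' : same_signs m i j i' j' -> R' i j -> R' i' j'.
    by move=> ss; apply: R_sign => k km; have [-> ->] := ss k km.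
  have R'_trans i j l : R' i j -> R' j l -> R' i l.
    by move=> ij jl; apply: R_trans jl ij.
  have R'_total i j k : (k < m)%N -> i k <> j k -> R' i j \/ R' j i.
    by move=> km ij; case: (R_total i j k km ij); [right|left].
  right; have lK := large_increasing R'_sign R'_trans R'_total uK' KP' (fun=> 0%N).
  by have := large_le nK lK; exact: large_subset.
Qed.

(** * Trees as an inductive type *)

(** This copy of [tree] allows runs, heights and convolutions to be defined by structural recursion;
    [represents] links the two. *)
Inductive btree (A : Type) :=
| Leaf of A
| Node of A & btree A & btree A.

Section BinaryTreeDefs.
Variable A : Type.
Implicit Types b l r : btree A.

Fixpoint blabel b (u : seq bool) : option A :=
  match b, u with
  | Leaf a, [::] | Node a _ _, [::] => Some a
  | Leaf _, _ :: _ => None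
  | Node _ l r, c :: u => blabel (if c then r else l) u
  end.

Fixpoint bmap (B : Type) (f : A -> B) b : btree B :=
  match b with
  | Leaf a => Leaf (f a)
  | Node a l r => Node (f a) (bmap f l) (bmap f r)
  end.

Fixpoint bheight b : nat :=
  if b is Node _ l r then (maxn (bheight l) (bheight r)).+1 else 0.

Fixpoint blevel b (n : nat) : seq (seq bool) :=
  match n, b with
  | 0, _ => [:: [::]]
  | _.+1, Leaf _ => [::]
  | n.+1, Node _ l r =>
      map (cons false) (blevel l n) ++ map (cons true) (blevel r n)
  end.

Fixpoint bdom b : seq (seq bool) :=
  if b is Node _ l r then
    [::] :: map (cons false) (bdom l) ++ map (cons true) (bdom r)
  else [:: [::]].

Definition broot b : A := match b with Leaf a | Node a _ _ => a end.

End BinaryTreeDefs.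

Section BinaryTrees.
Variable A : eqType.
Implicit Types b : btree A.

Lemma mem_bdom b u : (u \in bdom b) = (blabel b u != None).
Proof.
have inj c : injective (cons c : seq bool -> _) by move=> x y [].
have memN c (s : seq (seq bool)) : [::] \in map (cons c) s = false.
  by apply/negbTE/mapP => -[].
have memC c d v (s : seq (seq bool)) :
    (c :: v \in map (cons d) s) = (c == d) && (v \in s).
  have [->|cd] := eqVneq c d; first by rewrite mem_map.
  by apply/mapP => -[w _ [/eqP]]; rewrite (negPf cd).
elim: b u => [a|a l IHl r IHr] [|c u] //=; rewrite in_cons mem_cat.
by rewrite !memC /=; case: c; rewrite /= ?IHl ?IHr ?orbF.
Qed.

Lemma blabel_prefix b u v : blabel b u = None -> blabel b (u ++ v) = None.
Proof. by elim: b u => [a|a l IHl r IHr] [|[] u] //=; [exact: IHr|exact: IHl]. Qed.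

Lemma blabel_children b u :
  (blabel b (rcons u false) == None) = (blabel b (rcons u true) == None).
Proof.
elim: b u => [a|a l IHl r IHr] [|[] u] //=.
by case: l {IHl} => *; case: r {IHr} => *.
Qed.

Lemma blabel_inj b b' : blabel b =1 blabel b' -> b = b'.
Proof.
elim: b b' => [a|a l IHl r IHr] [a'|a' l' r'] e; have := e [::] => /= -[->] //.
- by have := e [:: false]; case: l' {e}.
- by have := e [:: false]; case: l {IHl e}.
- by congr Node; [apply: IHl => u; exact: (e (false :: u))
                 |apply: IHr => u; exact: (e (true :: u))].
Qed.

Lemma mem_blevel b u n : blabel b u != None -> size u = n -> u \in blevel b n.
Proof.
elim: b u n => [a|a l IHl r IHr] [|c u] [|n] //= bu [szu]; rewrite mem_cat.
by case: c bu => /[dup] bu ?; rewrite map_f ?orbT //; [apply: IHr|apply: IHl].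
Qed.

Lemma blevel_high b n : (bheight b < n)%N -> blevel b n = [::].
Proof.
elim: b n => [a|a l IHl r IHr] [|n] //=; rewrite ltnS gtn_max => /andP[hl hr].
by rewrite IHl ?IHr.
Qed.

Lemma size_blevel b n : (size (blevel b n) <= 2 ^ n)%N.
Proof.
elim: b n => [a|a l IHl r IHr] [|n] //=.
by rewrite size_cat !size_map expnS mul2n -addnn leq_add.
Qed.

End BinaryTrees.

Fixpoint bconv (A : Type) (s t : btree A) : btree (option A * option A) :=
  match s, t with
  | Leaf a, Leaf b => Leaf (Some a, Some b)
  | Node a l r, Leaf b => Node (Some a, Some b)
      (bmap (fun c => (Some c, None)) l) (bmap (fun c => (Some c, None)) r)
  | Leaf a, Node b l r => Node (Some a, Some b)
      (bmap (fun c => (None, Some c)) l) (bmap (fun c => (None, Some c)) r)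
  | Node a l r, Node b l' r' => Node (Some a, Some b) (bconv l l') (bconv r r')
  end.

Lemma blabel_bmap (A B : Type) (f : A -> B) b u :
  blabel (bmap f b) u = omap f (blabel b u).
Proof. by elim: b u => [a|a l IHl r IHr] [|[] u] /=. Qed.

Lemma blabel_bconv (A : Type) (s t : btree A) u :
  blabel (bconv s t) u =
    match blabel s u, blabel t u with
    | None, None => None
    | a, b => Some (a, b)
    end.
Proof.
elim: s t u => [a|a l IHl r IHr] [b|b l' r'] [|[] u] //=; rewrite ?blabel_bmap.
- by case: blabel.
- by case: blabel.
- by case: blabel.
- by case: blabel.
Qed.

Definition represents (A : finType) (t : tree A) (b : btree A) : Prop :=
  forall u, label t u = blabel b u.

Section Representation.
Variable A : finType.
Implicit Types (t : tree A) (b : btree A).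

Lemma mem_dom t u : (u \in dom t) = (label t u != None).
Proof. by rewrite /label /dom -fndSome; case: fnd. Qed.

Lemma label_inj t t' : label t =1 label t' -> t = t'.
Proof. by move=> e; apply/val_inj/fmapP => u; exact: e. Qed.

Lemma tree_represents b : exists t, represents t b.
Proof.
pose D := [fset u in bdom b]%fset.
have DE u : (u \in D) = (blabel b u != None) by rewrite inE mem_bdom.
pose f := [fmap u : D => odflt (broot b) (blabel b (val u))].
have fP : `[< tree_domain (domf f) >].
  apply/asboolP; split=> [|u v|u].
  - by apply/fset0Pn; exists [::]; rewrite DE; case: b {D DE f}.
  - by rewrite !DE; apply: contraNneq => /(@blabel_prefix _ b u v) ->.
  - by rewrite !DE blabel_children.
exists (Tree fP) => u; rewrite /label /=.
have [uD|uD] := boolP (u \in D).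
  rewrite in_fnd ffunE /=.
  by move: (uD); rewrite DE; case: blabel.
by rewrite not_fnd //; move: uD; rewrite DE negbK => /eqP.
Qed.

Lemma btree_represents t : exists b, represents t b.
Proof.
have /asboolP[D0 Dpre Dbin] := tree_mapP t.
have nil_dom : [::] \in dom t.
  by have /fset0Pn[u uD] := D0; apply: (Dpre [::] u).
pose H := \max_(u <- dom t) size u.
have szH u : u \in dom t -> (size u <= H)%N.
  by move=> uD; exact: leq_bigmax_seq.
(* [n] bounds the number of levels from [u] downwards, so at 0 the node [u] would be longer than
   [H]. *)
suff sub n u : u \in dom t -> (H < size u + n)%N ->
    exists b, forall v, label t (u ++ v) = blabel b v.
  by apply: (sub H.+1 [::]) => //=.
elim: n u => [|n IH] u uD; first by rewrite addn0 ltnNge szH.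
move=> lt_H; have := uD; rewrite mem_dom; case lab: (label t u) => [a|] // _.
have sz c : (H < size (rcons u c) + n)%N by rewrite size_rcons addSnnS.
have [u0|u0] := boolP (rcons u false \in dom t); last first.
  have u1 : rcons u true \notin dom t.
    by apply: contra u0 => u1; apply/Dbin.
  exists (Leaf a) => -[|c v] /=; first by rewrite cats0.
  apply/eqP; apply: contraTT (isT) => nN.
  have : rcons u c \in dom t.
    by apply: (Dpre _ v); rewrite cat_rcons; rewrite -mem_dom in nN.
  by case: c {nN} => uc; rewrite uc in u0 u1.
have u1 : rcons u true \in dom t by apply/Dbin.
have [l lP] := IH _ u0 (sz _); have [r rP] := IH _ u1 (sz _).
exists (Node a l r) => -[|[] v] /=; first by rewrite cats0.
  by rewrite -rP cat_rcons.
by rewrite -lP cat_rcons.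
Qed.

Lemma represents_conv t t' b b' : represents t b -> represents t' b' ->
  represents (tree_conv t t') (bconv b b').
Proof.
move=> tb t'b' u; rewrite blabel_bconv -tb -t'b' [LHS]/label /=.
have [uD|uD] := boolP (u \in dom t `|` dom t')%fset.
  rewrite (in_fnd uD) ffunE /=; move: (uD); rewrite in_fsetU !mem_dom.
  by case: label => //; case: label.
rewrite not_fnd //; move: uD; rewrite in_fsetU !mem_dom negb_or !negbK.
by case/andP=> /eqP-> /eqP->.
Qed.

Lemma tree_conv_inj t1 t2 t1' t2' :
  tree_conv t1 t2 = tree_conv t1' t2' -> t1 = t1' /\ t2 = t2'.
Proof.
have labE t t' u : label (tree_conv t t') u =
    match label t u, label t' u with None, None => None | a, b => Some (a, b) end.
  have [b tb] := btree_represents t; have [b' tb'] := btree_represents t'.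
  by rewrite (represents_conv tb tb') blabel_bconv -tb -tb'.
move=> e; split; apply: label_inj => u; have := labE t1 t2 u; rewrite e labE.
  by case: (label t1 u) => [a|]; case: (label t1' u) => [a'|];
    case: (label t2 u) => [b|]; case: (label t2' u) => [b'|] // -[] *; congruence.
by case: (label t1 u) => [a|]; case: (label t1' u) => [a'|];
  case: (label t2 u) => [b|]; case: (label t2' u) => [b'|] // -[] *; congruence.
Qed.

Lemma level_size_le t b n :
  represents t b -> (level_size t n <= size (blevel b n))%N.
Proof.
move=> tb; apply: uniq_leq_size => [|u]; first exact: fset_uniq.
rewrite !inE => /andP[uD /eqP szu]; apply: mem_blevel => //.
by rewrite -tb -mem_dom.
Qed.

Lemma thickness_level t b k : represents t b -> (k < thickness t)%N ->
  exists n, (k < size (blevel b n))%N.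
Proof.
move=> tb; rewrite ltnNge => thick; apply: contrapT => /forallNP small.
case/negP: thick; apply/bigmax_leqP_seq => u _ _.
apply: leq_trans (level_size_le _ tb) _.
by rewrite leqNgt; apply/negP.
Qed.

End Representation.

(** * Runs of tree automata by recursion *)

Section Runs.
Variables (A : finType) (M : tree_automaton A).

Fixpoint brun (b : btree A) : ta_state M :=
  match b with
  | Leaf a => ta_leaf M a
  | Node a l r => ta_node a (brun l) (brun r)
  end.

Fixpoint bsub (b : btree A) (u : seq bool) : btree A :=
  match b, u with
  | Node _ l r, c :: u => bsub (if c then r else l) u
  | _, _ => b
  end.

(** This is the condition of [tree_run] for the map sending [u] to [brun (bsub b u)]. *)
Lemma brun_bsub b u a : blabel b u = Some a ->
  brun (bsub b u) = if blabel b (rcons u false) != None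
    then ta_node a (brun (bsub b (rcons u false))) (brun (bsub b (rcons u true)))
    else ta_leaf M a.
Proof.
elim: b u => [a'|a' l IHl r IHr] [|[] u] //=; [by case=> -> | |exact: IHr|exact: IHl].
by case=> ->; case: l {IHl} => *; case: r {IHr} => *.
Qed.

Lemma tree_acceptsE t b :
  represents t b -> tree_accepts M t <-> brun b \in ta_final M.
Proof.
move=> tb; split=> [[rho run fin]|fin]; last first.
  exists (fun u => brun (bsub b u)) => [u a lab|]; last by case: b tb fin.
  by rewrite mem_dom tb; apply: brun_bsub; rewrite -tb.
suff rhoE u b' : (forall v, label t (u ++ v) = blabel b' v) -> rho u = brun b'.
  by rewrite -(rhoE [::] b).
elim: b' u => [a|a l IHl r IHr] u ub.
  have := ub [::]; rewrite cats0 /= => /run ->.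
  by rewrite mem_dom -cats1 ub.
have := ub [::]; rewrite cats0 /= => /run ->.
have -> : rcons u false \in dom t.
  by rewrite mem_dom -cats1 ub /=; case: l {IHl ub}.
by rewrite (IHl (rcons u false)) ?(IHr (rcons u true)) // => v; rewrite cat_rcons ub.
Qed.

End Runs.

(** * Independent replacement of subtrees in wide trees *)

Section Pumping.
Variables (A : finType) (M : tree_automaton A).
Variable M2 : tree_automaton (option A * option A)%type.

Definition unbounded_state (q : ta_state M) : Prop :=
  forall h, exists2 b, brun M b = q & (h <= bheight b)%N.

Lemma high_unbounded :
  exists H, forall b, (H <= bheight b)%N -> unbounded_state (brun M b).
Proof.
have [q h [b bq hb]|H HP] := @antitone_stabilizes _
  (fun q h => exists2 b, brun M b = q & (h <= bheight b)%N).
  by exists b => //; exact: ltnW.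
by exists H => b Hb; apply: HP; exists b.
Qed.

(** Trees of strictly increasing height with state [q] are pairwise distinct; Ramsey's theorem then
    thins them out. *)
Lemma unbounded_homogeneous q : unbounded_state q ->
  exists s : nat -> btree A, [/\ forall n, brun M (s n) = q,
    forall i j, i <> j -> s i <> s j &
    forall i j i' j', (i < j)%N = (i' < j')%N -> (j < i)%N = (j' < i')%N ->
      brun M2 (bconv (s i) (s j)) = brun M2 (bconv (s i') (s j'))].
Proof.
move=> unb.
pose Q (s : seq (btree A)) b :=
  brun M b = q /\ all (fun c => bheight c < bheight b)%N s.
have [s _|g gQ] := @history_choice _ Q.
  have [h hP] : exists h, all (fun c => bheight c < h)%N s.
    elim: s => [|c s [h hP]]; first by exists 0%N.
    exists (maxn h (bheight c).+1); rewrite /= leq_maxr /=.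
    by apply: sub_all hP => d dh; rewrite leq_max dh.
  have [b bq hb] := unb h; exists b; split=> //.
  by apply: sub_all hP => c ch; apply: leq_trans ch hb.
have g_height i j : (i < j)%N -> (bheight (g i) < bheight (g j))%N.
  move=> ij; have [_] := gQ j; rewrite all_map => /allP; apply.
  by rewrite mem_iota.
(* The colour records both orders of comparison and also the diagonal, so that equal indices give a
   constant state as well. *)
pose c i j := (brun M2 (bconv (g i) (g j)), brun M2 (bconv (g j) (g i)),
               brun M2 (bconv (g i) (g i))).
have [f [[[a1 a2] a3] fP]] := ramsey_pairs c.
exists (g \o f); split=> [n|i j|i j i' j' /=]; first by case: (gQ (f n)).
  by move=> /eqP; rewrite neq_ltn => /orP[] /fP[/g_height + _] /= e; rewrite e ltnn.
have lo x y : (x < y)%N -> brun M2 (bconv (g (f x)) (g (f y))) = a1.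
  by case/fP=> _ [].
have hi x y : (y < x)%N -> brun M2 (bconv (g (f x)) (g (f y))) = a2.
  by case/fP=> _ [].
have eq x : brun M2 (bconv (g (f x)) (g (f x))) = a3.
  by case/fP: (ltnSn x) => _ [].
have [ij|ji|<-] := ltngtP i j; have [i'j'|j'i'|<-] := ltngtP i' j' => // _ _.
- by rewrite !lo.
- by rewrite !hi.
- by rewrite !eq.
Qed.

(* [G] replaces [m] subtrees of [b] hanging off one path, each by the members
   of a homogeneous sequence, indexed by the first [m] values of its argument. *)
Definition flexible m (b : btree A) : Prop :=
  exists G : (nat -> nat) -> btree A, [/\ forall i, brun M (G i) = brun M b,
    forall i j k, (k < m)%N -> i k <> j k -> G i <> G j &
    forall i j i' j', same_signs m i j i' j' ->
      brun M2 (bconv (G i) (G j)) = brun M2 (bconv (G i') (G j'))].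

Lemma flexible0 b : flexible 0 b.
Proof. by exists (fun=> b). Qed.

Lemma flexible_nodel m a l r : flexible m l -> flexible m (Node a l r).
Proof.
case=> G [GM Ginj Gsign]; exists (fun i => Node a (G i) r).
split=> [i|i j k km ij [/(Ginj i j k km ij)//]|i j i' j' ss] /=; rewrite ?GM //.
by rewrite (Gsign _ _ _ _ ss).
Qed.

Lemma flexible_noder m a l r : flexible m r -> flexible m (Node a l r).
Proof.
case=> G [GM Ginj Gsign]; exists (fun i => Node a l (G i)).
split=> [i|i j k km ij [/(Ginj i j k km ij)//]|i j i' j' ss] /=; rewrite ?GM //.
by rewrite (Gsign _ _ _ _ ss).
Qed.

Let same_signsW m i j i' j' : same_signs m.+1 i j i' j' -> same_signs m i j i' j'.
Proof. by move=> ss k km; apply: ss; exact: ltnW. Qed.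

Lemma flexibleS_nodel m a l r : unbounded_state (brun M r) ->
  flexible m l -> flexible m.+1 (Node a l r).
Proof.
move=> /unbounded_homogeneous[s [sM sinj ssign]] [G [GM Ginj Gsign]].
exists (fun i => Node a (G i) (s (i m))); split=> [i|i j k|i j i' j' ss] /=.
- by rewrite GM sM.
- rewrite ltnS leq_eqVlt => /predU1P[-> ij [_ /(sinj _ _ ij)//]|km ij].
  by case=> /(Ginj i j k km ij).
- have [lt1 lt2] := ss m (ltnSn m).
  by rewrite (Gsign _ _ _ _ (same_signsW ss)) (ssign _ _ _ _ lt1 lt2).
Qed.

Lemma flexibleS_noder m a l r : unbounded_state (brun M l) ->
  flexible m r -> flexible m.+1 (Node a l r).
Proof.
move=> /unbounded_homogeneous[s [sM sinj ssign]] [G [GM Ginj Gsign]].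
exists (fun i => Node a (s (i m)) (G i)); split=> [i|i j k|i j i' j' ss] /=.
- by rewrite GM sM.
- rewrite ltnS leq_eqVlt => /predU1P[-> ij [/(sinj _ _ ij)//]|km ij].
  by case=> _ /(Ginj i j k km ij).
- have [lt1 lt2] := ss m (ltnSn m).
  by rewrite (Gsign _ _ _ _ (same_signsW ss)) (ssign _ _ _ _ lt1 lt2).
Qed.

(** If one child is lower than [H], the whole level lies in the other child. Otherwise both children
    have unbounded states: descend into one with more than half of the bound and make the other a
    new replaceable subtree. *)
Lemma wide_flexible H :
    (forall b, (H <= bheight b)%N -> unbounded_state (brun M b)) ->
  forall m b n, (2 ^ (H + m) < size (blevel b n))%N -> flexible m b.
Proof.
move=> Hunb m b; elim: b m => [a|a l IHl r IHr] [|m] n wide; try exact: flexible0.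
  by case: n wide => [|n] //=; rewrite ltnNge expn_gt0.
case: n wide => [|n wide]; first by rewrite /= ltnNge expn_gt0.
(* Level [n.+1] has at most [2 ^ n.+1] nodes, so it must be deep; hence a child of height below [H]
   has no node at its level [n]. *)
have Hn : (H <= n)%N.
  have := leq_trans wide (size_blevel (Node a l r) n.+1).
  by rewrite ltn_exp2l // addnS ltnS => /(leq_ltn_trans (leq_addr m H))/ltnW.
rewrite /= size_cat !size_map in wide.
have [Hl|lH] := leqP H (bheight l); last first.
  apply/flexible_noder/(IHr _ n).
  by rewrite (blevel_high (leq_trans lH Hn)) in wide.
have [Hr|rH] := leqP H (bheight r); last first.
  apply/flexible_nodel/(IHl _ n).
  by rewrite (blevel_high (leq_trans rH Hn)) addn0 in wide.
have [wl|wl] := ltnP (2 ^ (H + m)) (size (blevel l n)).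
  by apply: flexibleS_nodel (IHl _ _ wl); exact: Hunb.
apply: flexibleS_noder (IHr m n _); first exact: Hunb.
rewrite -(ltn_add2l (size (blevel l n))); apply: leq_trans wide.
by rewrite ltnS addnS expnS mul2n -addnn leq_add2r.
Qed.

End Pumping.

(** * Fat tree automatic orders are large in some direction *)

Lemma tree_automatic_large (A : finType) (L : set (tree A))
    (lt : L -> L -> Prop) n :
    tree_automatic_linear_order lt -> fat L ->
  large lt n [set: L] \/ large (fun x y => lt y x) n [set: L].
Proof.
case=> -[irr trans total] [M LE] [M2 ltE] L_fat.
have [H Hunb] := high_unbounded M.
(* This width yields [n.*2] independent coordinates, enough for [n] of them to agree in
   direction. *)
have [t Lt thick] := L_fat (2 ^ (H + n.*2))%N.
have [b tb] := btree_represents t.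
have [l wide] := thickness_level tb thick.
have [G [GM Ginj Gsign]] := wide_flexible M2 Hunb wide.
have accE s c : represents s c -> L s <-> brun M c \in ta_final M.
  by move=> sc; rewrite LE -(tree_acceptsE M sc).
have /choice[g gG] : forall i, exists x : L, represents (val x) (G i).
  move=> i; have [s sG] := tree_represents (G i).
  have Ls : s \in L by rewrite inE (accE _ _ sG) GM -(accE _ _ tb).
  by exists (exist _ s Ls).
have ltP i j : lt (g i) (g j) <-> brun M2 (bconv (G i) (G j)) \in ta_final M2.
  rewrite -(tree_acceptsE M2 (represents_conv (gG i) (gG j))).
  suff -> : tree_accepts M2 (tree_conv (val (g i)) (val (g j))) =
      [set w | exists s t : L, lt s t /\ w = tree_conv (val s) (val t)]
        (tree_conv (val (g i)) (val (g j))).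
    split=> [lt_ij|[x [y [lt_xy]]]]; first by exists (g i), (g j).
    by case/tree_conv_inj=> /val_inj-> /val_inj->.
  by rewrite ltE.
pose R i j := lt (g i) (g j).
have R_sign i j i' j' : same_signs n.*2 i j i' j' -> R i j -> R i' j'.
  by move=> /Gsign e; rewrite /R !ltP e.
have R_trans i j k : R i j -> R j k -> R i k by exact: trans.
have R_total i j k : (k < n.*2)%N -> i k <> j k -> R i j \/ R j i.
  move=> km /(Ginj i j k km) Gij.
  case: (total (g i) (g j)) => [|e|]; [by left| |by right].
  case: Gij; apply: blabel_inj => u.
  by rewrite -(gG i) -(gG j) e.
have image_large (R' : L -> L -> Prop) :
    large (fun i j => R' (g i) (g j)) n [set: nat -> nat] -> large R' n [set: L].
  move=> /(@large_rel _ _ _ R' (fun i x => x = g i)) im.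
  by apply: large_subset (im _ _) => // [i _|i x j y _ _ -> ->//]; exists (g i).
by have [] := sign_order_large (leqnn _) R_sign R_trans R_total; [left|right];
  exact: image_large.
Qed.

Theorem theorem5p1 (Sigma : finType) (L : set (tree Sigma))
    (lt : L -> L -> Prop)
    (L_tree_automatic : tree_automatic_linear_order lt)
    (L_scattered : scattered lt)
    (L_fat : fat L) :
  ~ word_automatic lt.
Proof.
have [lt_order _ _] := L_tree_automatic.
move=> /(word_automatic_bounded lt_order L_scattered)[k [nlt ngt]].
by have [] := tree_automatic_large k L_tree_automatic L_fat.
Qed.
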